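(* Let $X$ be a non-empty compact metric space. The function $\Delta_{\mathrm{L}}: \mathcal{K}(X) \times (0,1) \to \mathbb{R}$ defined by \[ \Delta_{\mathrm{L}}(F, \theta) = \dim_{\mathrm{L}}^\theta F \] is of Baire class 2 and, in particular, Borel measurable. Moreover, it is not in general of Baire class 1.
   Context: $\mathcal{K}(X)$ is the set of all non-empty compact subsets of $X$ with the Hausdorff metric $d_{\mathcal H}(E,F)=\inf\{\varepsilon>0: E\subseteq F_\varepsilon \text{ and } F\subseteq E_\varepsilon\}$, where $E_\varepsilon$ is the $\varepsilon$-neighbourhood of $E$; $\mathcal{K}(X)\times(0,1)$ carries the product topology and any compatible metric. A function between metric spaces is Baire class $0$ if it is continuous, and Baire class $n+1$ if it is a pointwise limit of a sequence of Baire class $n$ functions. For a subset $E$ of a metric space and $r>0$, $N(E,r)$ denotes the minimal number of balls of radius $r$ required to cover $E$, and $B(x,R)$ is the ball of radius $R$ centred at $x$. For $\theta\in(0,1)$, the lower spectrum of $F$ at $\theta$ is \[ \dim_{\mathrm L}^{\theta} F = \sup\Big\{\alpha : \exists C>0,\ \exists \rho>0,\ \forall\, 0<R\leq\rho,\ \forall x\in F,\ N(B(x,R)\cap F,R^{1/\theta})\geq C \big(R/R^{1/\theta}\big)^{\alpha}\Big\}. \]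
   Formalization: The spectrum can be +∞ (e.g. for the Hilbert cube), so the function is taken with extended real values, and the real-valued claim is stated whenever all values are finite; B(x,R) is read as a closed ball and the covering balls as open. *)

(* Defs.v *)
From HB Require Import structures.
From mathcomp Require Import all_boot all_order all_algebra.
From mathcomp Require Import all_classical all_reals all_analysis.

Set Implicit Arguments.
Unset Strict Implicit.
Unset Printing Implicit Defensive.

Import Order.TTheory GRing.Theory Num.Theory.
Import numFieldNormedType.Exports.

Local Open Scope classical_set_scope.
Local Open Scope ring_scope.

Section Baire.
Context {S T : topologicalType}.

(* Only the topologies matter, so that any compatible metrics may be used. *)
Fixpoint baire_class (n : nat) (f : S -> T) : Prop :=
  if n is m.+1 then
    exists g : nat -> S -> T, (forall k, baire_class m (g k)) /\
      forall x, g k x @[k --> \oo] --> f x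
  else continuous f.

Definition borel_measurable (f : S -> T) : Prop :=
  forall B : set T, <<s open >> B -> <<s open >> (f @^-1` B).

End Baire.

Section Hyperspace.
Context {R : realType}.

Record compacts (X : metricType R) := Compacts {
  compacts_set :> set X;
  compactsP : compact compacts_set;
  compacts_neq0 : compacts_set !=set0 }.

HB.instance Definition _ (X : metricType R) := gen_eqMixin (compacts X).
HB.instance Definition _ (X : metricType R) := gen_choiceMixin (compacts X).

Context {X : metricType R}.
Implicit Types E F G : compacts X.

Definition nbhd (E : set X) (e : R) : set X :=
  [set x | exists2 y, E y & mdist x y < e].

Definition hausdorff_radii (E F : set X) : set R :=
  [set e | [/\ 0 < e, E `<=` nbhd F e & F `<=` nbhd E e]].

Definition hausdorff_dist (E F : set X) : R := inf (hausdorff_radii E F).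

Lemma compacts_inj E F : compacts_set E = compacts_set F -> E = F.
Proof.
case: E => E cE E0; case: F => F cF F0 /= EF; subst F.
by congr Compacts; exact: Prop_irrelevance.
Qed.

Lemma compacts_bounded E (a : X) :
  \forall M \near +oo%R, forall x, compacts_set E x -> mdist a x < M.
Proof.
have /compact_near_coveringP cE := @compactsP _ E.
have := @cE R (pinfty_nbhs R) (fun M x => mdist a x < M) _; apply => x Ex.
exists (ball x 1, [set M : R | mdist a x + 1 < M]) => /=.
  split; first exact: nbhsx_ballx.
  by exists (mdist a x + 1); split; rewrite ?num_real.
move=> [y M] /= [xy aM]; rewrite (le_lt_trans (metric_triangle a x y))//.
rewrite (lt_trans _ aM)// ltrD2l.
by move: xy; rewrite ballEmdist.
Qed.

Lemma hausdorff_radii_neq0 E F : hausdorff_radii E F !=set0.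
Proof.
have [a Ea] := compacts_neq0 E; have [b Fb] := compacts_neq0 F.
have bE := compacts_bounded E b; have aF := compacts_bounded F a.
near (pinfty_nbhs R) => M; exists M; split.
- by near: M; exact: nbhs_pinfty_gt.
- move=> x Ex; exists b => //; rewrite metric_sym.
  by move: x Ex; near: M.
- move=> x Fx; exists a => //; rewrite metric_sym.
  by move: x Fx; near: M.
Unshelve. all: by end_near. Qed.

Lemma hausdorff_radii_lb E F : lbound (hausdorff_radii E F) 0.
Proof. by move=> e [/ltW]. Qed.

Lemma hausdorff_radii_has_inf E F : has_inf (hausdorff_radii E F).
Proof.
by split; [exact: hausdorff_radii_neq0 | exists 0; exact: hausdorff_radii_lb].
Qed.

Lemma hausdorff_dist_lt E F (e : R) : 0 < e ->
  hausdorff_dist E F < e -> exists2 d, hausdorff_radii E F d & d < e.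
Proof.
move=> e0; rewrite -subr_gt0 => EFe.
have [d Sd] := inf_adherent EFe (hausdorff_radii_has_inf E F).
by rewrite addrC subrK => de; exists d.
Qed.

Lemma hausdorff_dist_le E F (e : R) :
  hausdorff_radii E F e -> hausdorff_dist E F <= e.
Proof. by apply: ge_inf; exists 0; exact: hausdorff_radii_lb. Qed.

Lemma hausdorff_dist_ge0 E F : 0 <= hausdorff_dist E F.
Proof.
apply: lb_le_inf; first exact: hausdorff_radii_neq0.
exact: hausdorff_radii_lb.
Qed.

Lemma hausdorff_distxx E : hausdorff_dist E E = 0.
Proof.
apply/eqP; rewrite eq_le hausdorff_dist_ge0 andbT.
apply/ler_addgt0Pl => e e0; rewrite addr0; apply: hausdorff_dist_le.
by split=> // x Ex; exists x => //; rewrite mdistxx.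
Qed.

Lemma hausdorff_dist_sym E F : hausdorff_dist E F = hausdorff_dist F E.
Proof.
by congr inf; apply/seteqP; split=> e [? ? ?]; split.
Qed.

Lemma hausdorff_dist0_sub E F :
  hausdorff_dist E F = 0 -> compacts_set E `<=` compacts_set F.
Proof.
move=> EF0 x Ex.
have /closure_id -> := compact_closed (@metric_hausdorff R X) (@compactsP _ F).
move=> U; rewrite -filter_from_ballE => -[e e0 xeU].
have [|d [_ /(_ x Ex)[y Fy xy] _] de] := @hausdorff_dist_lt E F e e0.
  by rewrite EF0.
by exists y; split => //; apply: xeU; rewrite ballEmdist /= (lt_trans xy).
Qed.

Lemma hausdorff_dist_positivity E F : hausdorff_dist E F = 0 -> E = F.
Proof.
move=> EF0; apply: compacts_inj; apply/seteqP; split.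
  exact: hausdorff_dist0_sub.
by apply: hausdorff_dist0_sub; rewrite hausdorff_dist_sym.
Qed.

Lemma nbhd_trans (A B C : set X) (d e : R) :
  A `<=` nbhd B d -> B `<=` nbhd C e -> A `<=` nbhd C (d + e).
Proof.
move=> AB BC x /AB[y /BC[z Cz yz] xy]; exists z => //.
by rewrite (le_lt_trans (metric_triangle x y z))// ltrD.
Qed.

Lemma hausdorff_dist_triangle F E G :
  hausdorff_dist E G <= hausdorff_dist E F + hausdorff_dist F G.
Proof.
apply/ler_addgt0Pl => e e0; have e20 : 0 < e / 2 by rewrite divr_gt0.
have [d [d0 EF FE] dlt] :
    exists2 d, hausdorff_radii E F d & d < hausdorff_dist E F + e / 2.
  by apply: hausdorff_dist_lt; rewrite ?ltrDl// ltr_wpDl// hausdorff_dist_ge0.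
have [c [c0 FG GF] clt] :
    exists2 c, hausdorff_radii F G c & c < hausdorff_dist F G + e / 2.
  by apply: hausdorff_dist_lt; rewrite ?ltrDl// ltr_wpDl// hausdorff_dist_ge0.
apply: (@le_trans _ _ (d + c)).
  apply: hausdorff_dist_le; split; first exact: addr_gt0.
    exact: nbhd_trans EF FG.
  by rewrite addrC; exact: nbhd_trans GF FE.
by rewrite (le_trans (lerD (ltW dlt) (ltW clt)))// addrACA -splitr addrC.
Qed.

HB.instance Definition _ := isMetric.Build R (compacts X)
  hausdorff_distxx hausdorff_dist_positivity hausdorff_dist_sym
  hausdorff_dist_triangle.

End Hyperspace.

Section LowerSpectrum.
Context {R : realType} {X : metricType R}.

Definition metric_closed_ball (x : X) (t : R) : set X :=
  [set y | mdist x y <= t].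

(* The covering balls are open, with arbitrary centres in X; the value is +oo
   if there is no finite cover, which does not occur when X is compact. *)
Definition covering_number (E : set X) (r : R) : \bar R :=
  ereal_inf [set (size s)%:R%:E | s in
    [set s : seq X | E `<=` \bigcup_(c in [set` s]) ball c r]].

(* Localisation is by closed balls. The mix with open covering balls matters in
   a non-doubling X: it makes "N(B(x,t) /\ F, t^(1/theta)) < k for some x in F"
   an open condition on (F, theta). *)
Definition lower_spectrum (F : set X) (theta : R) : \bar R :=
  ereal_sup [set alpha%:E | alpha in [set alpha : R |
    exists C : R, 0 < C /\ exists rho : R, 0 < rho /\
      forall t : R, 0 < t <= rho -> forall x, F x ->
        ((C * (t / t `^ theta^-1) `^ alpha)%:E <=
          covering_number (metric_closed_ball x t `&` F)
                          (t `^ theta^-1))%E]].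

(* Extended-real valued: the spectrum can be +oo when X is not doubling. *)
Definition DeltaL (p : compacts X * `]0%R, 1%R[%classic) : \bar R :=
  lower_spectrum p.1 (set_val p.2).

End LowerSpectrum.
Arguments DeltaL {R} X p.

(* Main.v *)
From HB Require Import structures.
Require Import Defs.
From mathcomp Require Import all_boot all_order all_algebra.
From mathcomp Require Import all_classical all_reals all_analysis.
From mathcomp Require Import zify lra.

(** Write N for the covering number and B(x,t) for the closed ball.

    Upper bound.  Fix an exponent alpha >= 0, a constant C and a threshold rho.
    The pairs (F, theta) for which
      C (t / t^(1/theta))^alpha <= N(B(x,t) /\ F, t^(1/theta))
    holds at every x in F and every 0 < t <= rho form a closed set
    ([closed_lower_bound_level]): violating the inequality at some x and t means
    that a compact set, cut out by a closed ball, is covered by few open balls,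
    and such a cover has some slack, so it survives a small change of F, of x
    and of the radius ([closed_ball_cover_stable]).  The lower spectrum is the
    supremum of alpha times the indicator of these sets, and rational alpha and
    C, rho of the form 1/(m+1) are enough ([DeltaL_countable_sup]).  The
    indicator of a closed set is a limit of continuous functions, hence so is a
    finite maximum of such functions; the spectrum is the limit of these finite
    maxima, so it is of class 2 ([sup_closed_limit_of_baire1]).  The maxima are
    real-valued, so the same sequence serves for the extended-real and for the
    real version.  Every function of finite Baire class is Borel
    ([baire_class_borel]).

    Sharpness.  Let X be the Cantor space of binary sequences in which two
    points agreeing exactly on their first n digits are at distance 2^-n.  For
    b in X let F_b ([subcube]) be the set of the x whose digits are dominated by
    those of b.  The map b |-> F_b is 1-Lipschitz.  If b is eventually 0, then
    F_b is finite and has spectrum 0 ([DeltaL_subcube_finite]); if b is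
    eventually 1, then F_b is locally a full Cantor space and has spectrum at
    least 1 ([DeltaL_subcube_cofinite]).  Both kinds of b are dense.  If the
    spectrum were the limit of continuous g_k, then the b at which g_k < 1/3
    infinitely often and those at which g_k > 2/3 infinitely often would both
    form dense G_delta sets, and a common point, which the Baire category
    theorem provides ([cantor_baire]), would leave no value for the limit.  The
    spectrum is finite on all of X because X is covered by at most 2/r balls of
    radius r ([DeltaL_cantor_fin_num]). *)

Set Implicit Arguments.
Unset Strict Implicit.
Unset Printing Implicit Defensive.

Import Order.TTheory GRing.Theory Num.Theory.
Import numFieldNormedType.Exports.

Local Open Scope classical_set_scope.
Local Open Scope ring_scope.

(** * Baire classes and Borel measurability *)

Lemma baire_class_comp {S T U : topologicalType} (phi : T -> U) n (f : S -> T) :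
  continuous phi -> baire_class n f -> baire_class n (phi \o f).
Proof.
move=> cphi; elim: n f => [|n IH] f /=.
  by move=> cf x; apply: continuous_comp; [exact: cf|exact: cphi].
move=> [g [bg gf]]; exists (fun k => phi \o g k); split=> [k|x];
  first exact: IH.
by apply: continuous_cvg; [exact: cphi | exact: gf].
Qed.

Lemma baire_class_precomp {S T U : topologicalType} (phi : S -> T) n
    (f : T -> U) :
  continuous phi -> baire_class n f -> baire_class n (f \o phi).
Proof.
move=> cphi; elim: n f => [|n IH] f /=.
  by move=> cf x; apply: continuous_comp; [exact: cphi|exact: cf].
by move=> [g [bg gf]]; exists (fun k => g k \o phi); split=> [k|x];
  [exact: IH|exact: gf].
Qed.

Lemma borel_measurable_preimage_open {S T : topologicalType} (f : S -> T) :
  (forall U, open U -> <<s open >> (f @^-1` U)) -> borel_measurable f.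
Proof.
move=> fU B; apply: (@smallest_sub _ _ _ [set B | <<s open >> (f @^-1` B)])
  => //.
split=> /= [|A|A fA]; first by rewrite preimage_set0; exact: sigma_algebra0.
- by rewrite setTD preimage_setC -setTD; exact: sigma_algebraCD.
- by rewrite preimage_bigcup; exact: sigma_algebra_bigcup.
Qed.

(** The limit lies in an open U exactly when, for some radius e, the terms of
    the sequence eventually lie in the interior of the set of centres whose
    e-ball is contained in U. This needs balls of one radius at all points,
    hence the pseudometric on the target. *)
Lemma borel_measurable_lim {R : realType} {S : topologicalType}
    {T : pseudoMetricType R} (g : nat -> S -> T) (f : S -> T) :
  (forall k, borel_measurable (g k)) ->
  (forall x, g k x @[k --> \oo] --> f x) ->
  borel_measurable f.
Proof.
move=> bg gf; apply: borel_measurable_preimage_open => U oU.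
pose K (m : nat) := [set y | ball y m.+1%:R^-1 `<=` U].
suff -> : f @^-1` U =
    \bigcup_m \bigcup_N ~` \bigcup_k ~` (g (N + k)%N @^-1` (K m)°).
  apply: sigma_algebra_bigcup => m; apply: sigma_algebra_bigcup => N.
  rewrite -setTD; apply: sigma_algebraCD; apply: sigma_algebra_bigcup => k.
  rewrite -setTD; apply: sigma_algebraCD; apply: bg; apply: sub_gen_smallest.
  exact: open_interior.
apply/seteqP; split=> [x Ufx|x [m _ [N _ /= nx]]].
  have /nbhs_ballP[e /= e0 eU] : nbhs (f x) U by exact: open_nbhs_nbhs.
  (* One third of the radius each for: the limit to g_(N+k) x, that point to the
     centres z near it, and z to the points w of its ball. *)
  have [m me] : exists m, m.+1%:R^-1 < e / 3.
    have e30 : 0 < e / 3 by rewrite divr_gt0.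
    have [m _ /(_ m (leqnn m)) me] := near_infty_natSinv_lt (PosNum e30).
    by exists m.
  have m0 : 0 < m.+1%:R^-1 :> R by rewrite invr_gt0.
  exists m => //.
  have [N _ gN] : \forall k \near \oo, ball (f x) m.+1%:R^-1 (g k x).
    by apply: gf; exact: nbhsx_ballx.
  exists N => //= -[k _]; apply.
  apply: (@filterS _ _ _ (ball (g (N + k)%N x) m.+1%:R^-1)); last first.
    exact: nbhsx_ballx.
  move=> z gz w zw; apply: eU; apply: le_ball; last first.
    apply: ball_triangle zw; apply: ball_triangle gz; apply: gN => /=.
    exact: leq_addr.
  move: me; rewrite ltr_pdivlMr// => /ltW; apply: le_trans.
  by rewrite !mulrDr mulr1 addrA.
have m0 : 0 < m.+1%:R^-1 :> R by rewrite invr_gt0.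
have [M _ gM] : \forall k \near \oo, ball (f x) m.+1%:R^-1 (g k x).
  by apply: gf; exact: nbhsx_ballx.
have : K m (g (N + M)%N x).
  apply: interior_subset; apply: contrapT => h; apply: nx; by exists M.
by apply; apply: ball_sym; apply: gM => /=; exact: leq_addl.
Qed.

Lemma baire_class_borel {R : realType} {S : topologicalType}
    {T : pseudoMetricType R} n (f : S -> T) :
  baire_class n f -> borel_measurable f.
Proof.
elim: n f => [|n IH] f /=; last first.
  by move=> [g [/(_ _)/IH bg gf]]; exact: borel_measurable_lim bg gf.
move=> cf; apply: borel_measurable_preimage_open => U oU;
  apply: sub_gen_smallest.
by apply: open_comp => // x _; exact: cf.
Qed.

(** The approximants are max(0, 1 - k d), where d is the distance to E: they
    are 1 on E, and off the closed set E the distance d is positive. *)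
Lemma indic_closed_baire1 {R : realType} {S : pseudoMetricType R} (E : set S) :
  closed E -> exists h : nat -> S -> R,
    (forall k, continuous (h k)) /\
    forall p, h k p @[k --> \oo] --> (\1_E p : R).
Proof.
move=> cE; have [->|/set0P[a Ea]] := eqVneq E set0.
  exists (fun _ _ => 0); split=> [k x|p]; first exact: cvg_cst.
  by rewrite indic0; exact: cvg_cst.
(* Truncating at 1 keeps the possibly infinite distance of a pseudometric
   space finite. *)
pose dst p := mine (edist_inf E p) 1%E.
have dfin p : dst p \is a fin_num.
  rewrite ge0_fin_numE; first by rewrite /dst gt_min ltry orbT.
  by rewrite /dst le_min edist_inf_ge0 lee01.
have cd : continuous (fine \o dst).
  move=> p; apply: fine_cvg; rewrite fineK//.
  have := @min_fun_continuous _ _ _ (edist_inf E) (cst 1%E : S -> \bar R).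
  by apply; [exact: edist_inf_continuous|exact: cst_continuous].
exists (fun k p => Num.max 0 (1 - k%:R * fine (dst p))); split=> [k|p].
  move=> p; apply: (@continuous_max R S (fun=> 0)
    (fun p => 1 - k%:R * fine (dst p))).
    exact: cvg_cst.
  apply: (@cvgB R R^o); first exact: cvg_cst.
  by apply: (@cvgM R); [exact: cvg_cst|exact: cd].
have [Ep|nEp] := pselect (E p).
  rewrite indicE mem_set//= /dst edist_inf0// min_l ?lee01//=.
  by under eq_cvg do rewrite mulr0 subr0 max_r//; exact: cvg_cst.
rewrite indicE memNset//=.
have d0 : 0 < fine (dst p).
  apply: fine_gt0; rewrite ltey_eq dfin /= andbT /dst lt_min lte01 andbT.
  have : nbhs p (~` E) by apply: open_nbhs_nbhs; split=> //;
    exact: closed_openC.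
  move=> /nbhs_ballP[e /= e0 eE]; apply: (@lt_le_trans _ _ e%:E);
    first by rewrite lte_fin.
  apply: le_ereal_inf_tmp => _ [b Eb <-]; rewrite leNgt;
    apply/negP => /edist_lt_ball/=.
  by move=> /eE.
apply: cvg_near_cst; near=> k.
apply/eqP; rewrite eq_le; apply/andP; split; last by rewrite le_max lexx.
rewrite ge_max lexx/= subr_le0 -ler_pdivrMr// mul1r.
by near: k; exact: nbhs_infty_ger.
Unshelve. all: by end_near. Qed.

Definition running_max {R : realType} (u : nat -> R) (n : nat) : R :=
  iteri n (fun i r => Num.max r (u i)) 0.

(** Only closed sets enter, so the supremum sits one class above their
    indicators.  The approximants are real-valued even where the supremum is
    infinite. *)
Lemma sup_closed_limit_of_baire1 {R : realType} {S : pseudoMetricType R}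
    (E : nat -> set S) (a : nat -> R) (f : S -> \bar R) :
    (forall i, closed (E i)) -> (forall i, 0 <= a i) ->
    (forall p, f p = ereal_sup (range (fun i => (a i * \1_(E i) p)%:E))) ->
  exists g : nat -> S -> R, (forall n, baire_class 1 (g n)) /\
    forall p, (g n p)%:E @[n --> \oo] --> f p.
Proof.
move=> cE a0 fE.
exists (fun n p => running_max (fun i => a i * \1_(E i) p) n); split=> [n|p].
  have /choice[h hP] i := indic_closed_baire1 (cE i).
  exists (fun k p => running_max (fun i => a i * h i k p) n); split=> [k|p].
    elim: n => [|n IH] p; first exact: cvg_cst.
    apply: (@continuous_max R S
      (fun p => running_max (fun i => a i * h i k p) n)
      (fun p => a n * h n k p)); first exact: IH.
    by apply: (@cvgM R); [exact: cvg_cst|exact: (hP n).1].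
  elim: n => [|n IH]; first exact: cvg_cst.
  apply: (@continuous2_cvg _ _ _ _ _ _
      (fun k => running_max (fun i => a i * h i k p) n)
      (fun k => a n * h n k p) Num.max) => //.
    exact: (@max_continuous _ R (_, _)).
  by apply: (@cvgM R); [exact: cvg_cst|exact: (hP n).2].
pose u i := a i * \1_(E i) p; pose g n := (running_max u n)%:E; rewrite fE -/u.
have gnd : {homo g : n m / (n <= m)%N >-> (n <= m)%E}.
  apply: homo_leq => [//|y x z|n]; first exact: le_trans.
  by rewrite /= lee_fin /running_max/= le_max lexx.
suff -> : ereal_sup (range (fun i => (u i)%:E)) = ereal_sup (range g).
  exact: ereal_nondecreasing_cvgn.
apply/eqP; rewrite eq_le; apply/andP; split; apply: ge_ereal_sup => _ [n _ <-].
  apply: (@le_trans _ _ (g n.+1)); last by apply: ereal_sup_ubound; exists n.+1.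
  by rewrite lee_fin /running_max/= le_max lexx orbT.
elim: n => [|n IH].
  apply: (@le_trans _ _ (u 0%N)%:E); first by rewrite lee_fin mulr_ge0// indicE.
  by apply: ereal_sup_ubound; exists 0%N.
rewrite /g /running_max/= EFin_max ge_max IH/=.
by apply: ereal_sup_ubound; exists n.
Qed.

(** * Covering numbers and the closed levels *)

Section CoveringNumber.
Context {R : realType} {X : metricType R}.
Implicit Types (E : set X) (F : compacts X) (x : X) (t r : R) (s : seq X).

Lemma covering_number_le_size E r s :
  E `<=` \bigcup_(c in [set` s]) ball c r ->
  (covering_number E r <= (size s)%:R%:E)%E.
Proof. by move=> Es; apply: ereal_inf_lbound; exists s. Qed.

Lemma le_covering_number E r (v : R) :
  (forall s, E `<=` \bigcup_(c in [set` s]) ball c r -> v <= (size s)%:R) ->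
  (v%:E <= covering_number E r)%E.
Proof.
by move=> vs; apply: le_ereal_inf_tmp => _ [s Es <-]; rewrite lee_fin vs.
Qed.

Lemma covering_number_ge1 E r : E !=set0 -> (1 <= covering_number E r)%E.
Proof.
move=> [x Ex]; apply: le_covering_number => s /(_ x Ex)[c /= cs _].
by rewrite ler1n; case: s cs.
Qed.

(** The slack of a cover by open balls: by compactness of F a single d works for
    enlarging F by d and the closed ball by d while shrinking the covering balls
    by d.  Near a point of F inside the closed ball the slack comes from a
    covering ball, near a point outside it from the distance to that ball. *)
Lemma closed_ball_cover_stable F x t r s :
    metric_closed_ball x t `&` F `<=` \bigcup_(c in [set` s]) ball c r ->
  exists2 d, 0 < d & forall y, nbhd F d y -> mdist x y <= t + d ->
    exists2 c, c \in s & mdist c y < r - d.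
Proof.
move=> Fs.
pose P (d : R) (z : X) := forall y, mdist z y < d -> mdist x y <= t + d ->
  exists2 c, c \in s & mdist c y < r - d.
have : \forall d \near 0^'+, compacts_set F `<=` P d.
  have /compact_near_coveringP cF := @compactsP _ _ F.
  apply: (@cF R 0^'+ P) => z Fz.
  have [xz|xz] := leP (mdist x z) t.
    have [//|c /= cs cz] := Fs z.
    rewrite ballEmdist/= in cz; pose e := (r - mdist c z) / 3.
    have e0 : 0 < e by rewrite divr_gt0// subr_gt0.
    exists (ball z e, [set d | 0 < d < e]) => /=.
      split; first exact: nbhsx_ballx.
      by near=> d; apply/andP; split; near: d;
        [exact: nbhs_right_gt|exact: nbhs_right_lt].
    move=> [z' d] /= [zz' /andP[d0 de]] y zy _; exists c => //.
    rewrite ballEmdist/= in zz'.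
    have := metric_triangle c z y; have := metric_triangle z z' y.
    by move: zz' de zy; rewrite /e; lra.
  pose e := (mdist x z - t) / 3.
  have e0 : 0 < e by rewrite divr_gt0// subr_gt0.
  exists (ball z e, [set d | 0 < d < e]) => /=.
    split; first exact: nbhsx_ballx.
    by near=> d; apply/andP; split; near: d;
      [exact: nbhs_right_gt|exact: nbhs_right_lt].
  move=> [z' d] /= [zz' /andP[d0 de]] y zy xy; exfalso.
  rewrite ballEmdist/= in zz'.
  have := metric_triangle x y z; have := metric_triangle y z' z.
  rewrite (metric_sym y z') (metric_sym z' z).
  by move: zz' de zy xy; rewrite /e; lra.
move=> FP; near (0:R)^'+ => d; exists d; first by near: d; exact: nbhs_right_gt.
move=> y [z Fz yz] xy; have Pd : compacts_set F `<=` P d by near: d.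
by apply: (Pd z Fz y) => //; rewrite metric_sym.
Unshelve. all: by end_near. Qed.

End CoveringNumber.

Section ClosedLevels.
Context {R : realType} {X : metricType R}.
Local Notation S := (compacts X * `]0%R : R, 1%R[%classic)%type.

Lemma exponent_gt0 (p : S) : 0 < set_val p.2 :> R.
Proof. by have := set_valP p.2; rewrite /= in_itv/= => /andP[]. Qed.

Lemma exponent_lt1 (p : S) : set_val p.2 < 1 :> R.
Proof. by have := set_valP p.2; rewrite /= in_itv/= => /andP[]. Qed.

Lemma continuous_powR_inv_exponent (t : R) : 0 < t ->
  continuous (fun p : S => t `^ (set_val p.2)^-1).
Proof.
move=> t0 p; rewrite /powR gt_eqF//.
apply: (@continuous_comp _ _ _ (fun p : S => (set_val p.2)^-1 * ln t) expR).
  apply: (@cvgM R); last exact: cvg_cst.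
  apply: cvgV; first by rewrite gt_eqF// exponent_gt0.
  apply: (@continuous_comp _ _ _ snd set_val); first exact: cvg_snd.
  exact: initial_continuous.
exact: continuous_expR.
Qed.

Definition lower_bound_level (alpha C rho : R) : set S :=
  [set p | forall t : R, 0 < t <= rho -> forall x, compacts_set p.1 x ->
    ((C * (t / t `^ (set_val p.2)^-1) `^ alpha)%:E <=
       covering_number (metric_closed_ball x t `&` compacts_set p.1)
                       (t `^ (set_val p.2)^-1))%E].

(** The complement is open: a cover witnessing the failure at x in F transfers
    to every nearby (F', theta'), at a point x' of F' close to x. *)
Lemma closed_lower_bound_level (alpha C rho : R) :
  closed (lower_bound_level alpha C rho).
Proof.
rewrite -openC openE => p /existsNP[t /not_implyP[trho]].
move=> /existsNP[x /not_implyP[px /negP]]; rewrite -ltNge.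
have t0 : 0 < t by case/andP: trho.
pose r (q : S) := t `^ (set_val q.2)^-1.
pose v (q : S) := C * (t / r q) `^ alpha.
have cr : continuous r by exact: continuous_powR_inv_exponent.
have r0 q : 0 < r q by exact: powR_gt0.
have cv : continuous v.
  have -> : v = fun q => C * expR (alpha * (ln t - ln (r q))).
    apply/funext => q; rewrite /v /powR gt_eqF ?divr_gt0//.
    by rewrite ln_div// posrE.
  move=> q; apply: (@cvgM R); first exact: cvg_cst.
  apply: (@continuous_comp _ _ _ (fun q => alpha * (ln t - ln (r q))) expR);
    last exact: continuous_expR.
  apply: (@cvgM R); first exact: cvg_cst.
  apply: (@cvgB R R^o); first exact: cvg_cst.
  by apply: (@continuous_comp _ _ _ r (@ln R));
    [exact: cr|exact: continuous_ln].
move=> /ereal_inf_lt[_ [s Fs <-]]; rewrite lte_fin => sv.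
have [d d0 dP] := closed_ball_cover_stable Fs.
have near_r : \forall q \near p, r p - d < r q.
  by apply: (cvgr_gt _ (cr p)); rewrite ltrBlDr ltrDl.
have near_v : \forall q \near p, (size s)%:R < v q by apply: (cvgr_gt _ (cv p)).
have near_F : nbhs p [set q : S | hausdorff_dist p.1 q.1 < d].
  have fp : (fst q : compacts X) @[q --> p] --> p.1 by exact: cvg_fst.
  by have := fp _ (nbhsx_ballx p.1 d d0); rewrite ballEmdist.
rewrite /interior; near=> q => /(_ t trho).
have [e [e0 pq qp] ed] : exists2 e, hausdorff_radii p.1 q.1 e & e < d.
  by apply: hausdorff_dist_lt => //; near: q.
have [x' qx' xx'] := pq x px.
move=> /(_ x' qx'); apply/negP; rewrite -ltNge.
apply: (@le_lt_trans _ _ (size s)%:R%:E); last by rewrite lte_fin; near: q.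
apply: covering_number_le_size => y [/= x'y qy].
have [z Fz yz] := qp y qy.
have [||c cs cy] := dP y.
- by exists z => //; exact: lt_trans ed.
- have := metric_triangle x x' y; rewrite /metric_closed_ball/= in x'y.
  by move: x'y xx' ed; lra.
exists c => //=; rewrite ballEmdist/=; apply: lt_trans cy _.
by near: q.
Unshelve. all: by end_near. Qed.

End ClosedLevels.

(** * The lower spectrum as a countable supremum *)

Section CountableSup.
Context {R : realType} {X : metricType R}.
Local Notation S := (compacts X * `]0%R : R, 1%R[%classic)%type.

Lemma scale_ratioE (t b : R) : 0 < t -> t / t `^ b = t `^ (1 - b).
Proof.
move=> t0; have tn0 : t != 0 by rewrite gt_eqF.
by rewrite powRB ?tn0 ?implybT// powRr1// ltW.
Qed.

Lemma scale_ratio_ge1 (t b : R) : 0 < t <= 1 -> 1 <= b -> 1 <= t / t `^ b.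
Proof.
move=> t01 b1; have /andP[t0 _] := t01.
rewrite ler_pdivlMr ?powR_gt0// mul1r -[leRHS]powRr1 ?(ltW t0)//.
exact: (ger_powR t01 b1).
Qed.

Lemma level_le_DeltaL (p : S) (alpha C rho : R) : 0 < C -> 0 < rho ->
  lower_bound_level alpha C rho p -> (alpha%:E <= DeltaL X p)%E.
Proof.
move=> C0 rho0 pl; apply: ereal_sup_ubound; exists alpha => //.
by exists C; split=> //; exists rho.
Qed.

Lemma DeltaL_ge0 (p : S) : (0 <= DeltaL X p)%E.
Proof.
apply: (@level_le_DeltaL p 0 1 1) => // t /andP[t0 _] x px.
rewrite powRr0 mulr1; apply: covering_number_ge1; exists x; split=> //.
by rewrite /metric_closed_ball/= mdistxx ltW.
Qed.

(** An enumeration of triples (q, m, k), standing for the exponent |q| and the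
    constants C = 1/(m+1), rho = 1/(k+1); the default, too, is a valid triple. *)
Definition parameters (i : nat) : rat * nat * nat :=
  odflt (0%Q, 0%N, 0%N) (unpickle i).
Definition level_exponent (i : nat) : R := `|ratr (parameters i).1.1|.
Definition level (i : nat) : set S :=
  lower_bound_level (level_exponent i)
    (parameters i).1.2.+1%:R^-1 (parameters i).2.+1%:R^-1.

(** The inequality defining a level weakens when alpha, C or rho decreases, for
    alpha because t / t^(1/theta) >= 1 when t <= 1, and the enumerated rho are
    at most 1; so smaller enumerated parameters may replace real ones. *)
Lemma DeltaL_countable_sup (p : S) :
  DeltaL X p =
  ereal_sup (range (fun i => (level_exponent i * \1_(level i) p)%:E)).
Proof.
set M := ereal_sup (range _).
have M0 : (0 <= M)%E.
  apply: (@le_trans _ _ (level_exponent 0 * \1_(level 0) p)%:E).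
    by rewrite lee_fin mulr_ge0// normr_ge0.
  by apply: ereal_sup_ubound; exists 0%N.
apply/eqP; rewrite eq_le; apply/andP; split; last first.
  apply: ge_ereal_sup => _ [i _ <-]; rewrite indicE.
  have [/set_mem pl|_] := boolP (p \in level i);
    last by rewrite mulr0 DeltaL_ge0.
  by rewrite mulr1; apply: level_le_DeltaL pl; rewrite invr_gt0.
apply: ge_ereal_sup => _ [alpha [C [C0 [rho [rho0 lev]]]] <-].
rewrite leNgt; apply/negP => Malpha.
have Mfin : M \is a fin_num by rewrite ge0_fin_numE// (lt_trans Malpha) ?ltry.
have : fine M < alpha by rewrite -lte_fin fineK.
move=> /rat_in_itvoo[q]; rewrite in_itv/= => /andP[Mq qalpha].
have q0 : 0 < ratr q :> R by rewrite (le_lt_trans _ Mq)// fine_ge0.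
have small (e : R) : 0 < e -> exists m : nat, m.+1%:R^-1 < e.
  move=> e0; have [m _ me] := near_infty_natSinv_lt (PosNum e0).
  by exists m; exact: (me m (leqnn m)).
have [m mC] := small _ C0; have [k krho] := small _ rho0.
have := Mq; apply/negP; rewrite -leNgt -lee_fin fineK//.
have [i iE] : exists i, parameters i = (q, m, k).
  by exists (pickle (q, m, k)); rewrite /parameters pickleK.
apply: ereal_sup_ubound; exists i => //.
rewrite /level /level_exponent iE/=.
rewrite gtr0_norm// indicE mem_set/= ?mulr1// => t /andP[t0 tk] x px.
have trho : 0 < t <= rho by rewrite t0 (le_trans tk)// ltW.
apply: le_trans (lev t trho x px); rewrite lee_fin.
apply: ler_pM => //; [by rewrite powR_ge0| exact: ltW|].
apply: ler_powR; last exact: ltW.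
apply: scale_ratio_ge1;
  last by rewrite invf_ge1 ?exponent_gt0// ltW// exponent_lt1.
by rewrite t0 (le_trans tk)// invf_le1// ler1n.
Qed.

Lemma DeltaL_limit_of_baire1 : exists g : nat -> S -> R,
  (forall n, baire_class 1 (g n)) /\
  forall p, (g n p)%:E @[n --> \oo] --> DeltaL X p.
Proof.
apply: (sup_closed_limit_of_baire1 (E := level) (a := level_exponent)).
- by move=> i; exact: closed_lower_bound_level.
- by move=> i; exact: normr_ge0.
- exact: DeltaL_countable_sup.
Qed.

Lemma continuous_EFin : continuous (EFin : R -> \bar R).
Proof. by move=> x; apply: cvg_EFin; [exact: nearW|exact: cvg_id]. Qed.

Lemma DeltaL_baire2 : baire_class 2 (DeltaL X).
Proof.
have [g [g1 gD]] := DeltaL_limit_of_baire1.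
exists (fun n => EFin \o g n); split=> // n.
by apply: baire_class_comp => //; exact: continuous_EFin.
Qed.

Lemma fine_DeltaL_baire2 : (forall p, DeltaL X p \is a fin_num) ->
  baire_class 2 (fine \o DeltaL X).
Proof.
have [g [g1 gD]] := DeltaL_limit_of_baire1 => Dfin.
exists g; split=> // p; apply: (@fine_cvg _ _ _ _ (EFin \o g^~ p)).
by rewrite /= fineK//; exact: gD.
Qed.

End CountableSup.

(** * Bounding the spectrum and covering numbers *)

Section ExponentUpperBound.
Context {R : realType} {X : metricType R}.
Local Notation S := (compacts X * `]0%R : R, 1%R[%classic)%type.

(** If alpha > beta / (b - 1) were admissible, comparing the two bounds on the
    covering number would give C <= K t^gam with gam = alpha (b - 1) - beta > 0
    for all small t, which fails as t tends to 0. *)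
Lemma DeltaL_le (p : S) (K beta : R) : let b := (set_val p.2)^-1 in
  (\forall t \near 0^'+, exists2 x, compacts_set p.1 x &
     (covering_number (metric_closed_ball x t `&` compacts_set p.1) (t `^ b)
        <= (K * t `^ (- beta))%:E)%E) ->
  (DeltaL X p <= (beta / (b - 1))%:E)%E.
Proof.
move=> b small; have b1 : 0 < b - 1.
  by rewrite subr_gt0 invf_gt1 ?exponent_gt0 ?exponent_lt1.
apply: ge_ereal_sup => _ [alpha [C [C0 [rho [rho0 lev]]]] <-].
rewrite lee_fin leNgt; apply/negP; rewrite ltr_pdivrMr// -subr_gt0.
set gam := _ - beta => gam0.
have K0 : (K * t `^ gam) @[t --> 0^'+] --> K * 0.
  by apply: (@cvgM R); [exact: cvg_cst|exact: powR_cvg0].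
rewrite mulr0 in K0.
near (0:R)^'+ => t.
have t0 : 0 < t by near: t; exact: nbhs_right_gt.
have : K * t `^ gam < C by near: t; exact: (cvgr_lt _ K0).
apply/negP; rewrite -leNgt.
have [x px] : exists2 x, compacts_set p.1 x &
     (covering_number (metric_closed_ball x t `&` compacts_set p.1) (t `^ b)
        <= (K * t `^ (- beta))%:E)%E by near: t.
have trho : 0 < t <= rho by rewrite t0; near: t; exact: nbhs_right_le.
move/(le_trans (lev t trho x px)).
rewrite lee_fin scale_ratioE// -powRrM.
have tn0 : t != 0 by rewrite gt_eqF.
have -> : t `^ gam = t `^ (- beta) * t `^ (alpha * (b - 1)).
  by rewrite -powRD ?tn0 ?implybT// addrC.
have -> : (1 - b) * alpha = - (alpha * (b - 1)) by lra.
by rewrite powRN ler_pdivrMr ?powR_gt0// mulrA.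
Unshelve. all: by end_near. Qed.

End ExponentUpperBound.

(** Choosing for every w a covering ball that contains e w is injective. *)
Lemma card_le_covering_number {R : realType} {X : metricType R} {W : finType}
    (E : set X) (r : R) (e : W -> X) :
    (forall w, E (e w)) ->
    (forall c w w', ball c r (e w) -> ball c r (e w') -> w = w') ->
  ((#|W|%:R)%:E <= covering_number E r)%E.
Proof.
move=> eE esep; apply: le_covering_number => s Es; rewrite ler_nat.
have /choice[f fP] w : exists c, c \in s /\ ball c r (e w).
  by have [c cs cw] := Es _ (eE w); exists c.
have finj : injective f.
  move=> w w' ff; apply: (esep (f w)); first exact: (fP w).2.
  by rewrite ff; exact: (fP w').2.
rewrite cardE -(size_map f); apply: uniq_leq_size.
  by rewrite map_inj_uniq// enum_uniq.
by move=> _ /mapP[w _ ->]; exact: (fP w).1.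
Qed.

Lemma powR_le1 {R : realType} (t a : R) : 0 < t <= 1 -> 0 <= a -> t `^ a <= 1.
Proof.
by move=> t01 a0; rewrite -[leRHS](powRr0 t); exact: (ger_powR t01 a0).
Qed.

Lemma dyadic_scale {R : realType} (r : R) : 0 < r <= 1 ->
  exists m : nat, 2 ^- m.+1 < r <= 2 ^- m.
Proof.
move=> /andP[r0 r1].
have ex : exists m : nat, 2 ^- m < r.
  have h2 : `|2^-1 : R| < 1 by rewrite ger0_norm// invf_lt1// ltr1n.
  have := cvgr_lt _ (cvg_expr h2) _ r0.
  by move=> [m _ /(_ m (leqnn m))] /=; rewrite exprVn; exists m.
case: (ex_minnP ex) => -[|m] mr min.
  by move: mr; rewrite expr0 invr1 ltNge r1.
by exists m; rewrite mr leNgt; apply/negP => /min; rewrite ltnn.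
Qed.

(** * The Cantor space and its ultrametric *)

(** A fresh name, so that the sequences carry the metric below instead of an
    inherited product structure. *)
Definition cantor (R : realType) : Type := nat -> bool.

Section CantorMetric.
Context {R : realType}.
Local Notation cantor := (cantor R).
Implicit Types (x y z : cantor) (n m : nat).

HB.instance Definition _ := gen_eqMixin cantor.
HB.instance Definition _ := gen_choiceMixin cantor.

Definition agree n x y := forall i, (i < n)%N -> x i = y i.

Lemma agree_sym n x y : agree n x y -> agree n y x.
Proof. by move=> xy i ni; rewrite xy. Qed.

Lemma agree_trans n x y z : agree n x y -> agree n y z -> agree n x z.
Proof. by move=> xy yz i ni; rewrite xy// yz. Qed.

Lemma agree_le n m x y : (n <= m)%N -> agree m x y -> agree n x y.
Proof. by move=> nm xy i ni; apply: xy; exact: leq_trans nm. Qed.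

Definition cantor_radii x y : set R :=
  [set 2 ^- n | n in [set n | agree n x y]].

Definition cantor_dist x y : R := inf (cantor_radii x y).

Lemma cantor_radii_has_inf x y : has_inf (cantor_radii x y).
Proof.
split; first by exists 1, 0%N => //=; rewrite expr0 invr1.
by exists 0 => _ [n _ <-]; rewrite invr_ge0 exprn_ge0.
Qed.

Lemma cantor_dist_le n x y : agree n x y -> cantor_dist x y <= 2 ^- n.
Proof.
by move=> xy; apply: ge_inf; [exact: (cantor_radii_has_inf x y).2|exists n].
Qed.

Lemma agree_cantor_dist n x y : cantor_dist x y <= 2 ^- n -> agree n x y.
Proof.
(* A radius below 2 * 2^-n is at most 2^-n, both being powers of 2. *)
move=> xyn; have n0 : 2 ^- n < 2 * 2 ^- n :> R.
  by rewrite ltr_pMl ?ltr1n// invr_gt0 exprn_gt0.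
have := le_lt_trans xyn n0.
move=> /(inf_lt (cantor_radii_has_inf x y).1)[_ [m xym <-] mn];
  apply: agree_le xym.
rewrite leqNgt; apply/negP => nm; move: mn; apply/negP; rewrite -leNgt.
rewrite -ler_pdivlMl// -invfM -exprS lef_pV2 ?posrE ?exprn_gt0//.
by rewrite ler_weXn2l// ler1n.
Qed.

Lemma small_exp2 (e : R) : 0 < e -> exists n : nat, 2 ^- n < e.
Proof.
move=> e0; have /dyadic_scale[n /andP[ne _]] : 0 < Num.min e 1 <= 1.
  by rewrite lt_min e0 ltr01 ge_min lexx orbT.
by exists n.+1; apply: lt_le_trans ne _; rewrite ge_min lexx.
Qed.

Lemma cantor_distxx x : cantor_dist x x = 0.
Proof.
apply/eqP; rewrite eq_le; apply/andP; split.
  apply/ler_addgt0Pl => e /small_exp2[n ne]; rewrite addr0.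
  by rewrite (le_trans _ (ltW ne))// cantor_dist_le.
apply: lb_le_inf; first exact: (cantor_radii_has_inf x x).1.
by move=> _ [n _ <-]; rewrite invr_ge0 exprn_ge0.
Qed.

Lemma cantor_dist_positivity x y : cantor_dist x y = 0 -> x = y.
Proof.
move=> xy0; apply/funext => i; apply: (@agree_cantor_dist i.+1) => //.
by rewrite xy0 invr_ge0 exprn_ge0.
Qed.

Lemma cantor_dist_sym x y : cantor_dist x y = cantor_dist y x.
Proof.
by congr inf; apply/seteqP; split=> _ [n xy <-]; exists n => //;
  exact: agree_sym.
Qed.

Lemma cantor_dist_triangle y x z :
  cantor_dist x z <= cantor_dist x y + cantor_dist y z.
Proof.
rewrite -lerBlDr; apply: lb_le_inf; first exact: (cantor_radii_has_inf x y).1.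
move=> _ [n xy <-]; rewrite lerBlDr addrC -lerBlDr.
apply: lb_le_inf; first exact: (cantor_radii_has_inf y z).1.
move=> _ [m yz <-]; rewrite lerBlDr.
have n0 : 0 <= 2 ^- n :> R by rewrite invr_ge0 exprn_ge0.
have m0 : 0 <= 2 ^- m :> R by rewrite invr_ge0 exprn_ge0.
have [nm|/ltnW mn] := leqP n m.
  rewrite (@le_trans _ _ (2 ^- n))// ?lerDr//; apply: cantor_dist_le.
  by apply: agree_trans xy _; exact: agree_le yz.
rewrite (@le_trans _ _ (2 ^- m))// ?lerDl//; apply: cantor_dist_le.
by apply: agree_trans yz; exact: agree_le xy.
Qed.

HB.instance Definition _ := isMetric.Build R cantor
  cantor_distxx cantor_dist_positivity cantor_dist_sym cantor_dist_triangle.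

Lemma mdist_cantor_le n x y : agree n x y -> mdist x y <= 2 ^- n :> R.
Proof. exact: cantor_dist_le. Qed.

Lemma agree_mdist_cantor n x y : mdist x y <= 2 ^- n :> R -> agree n x y.
Proof. exact: agree_cantor_dist. Qed.

Lemma nbhs_cantorP x (A : set cantor) :
  nbhs x A <-> exists n, forall y, agree n x y -> A y.
Proof.
split=> [/nbhs_ballP[e /= e0 xA]|[n xA]].
  have [n ne] := small_exp2 e0; exists n => y xy; apply: xA.
  by rewrite ballEmdist/=; apply: le_lt_trans ne; exact: mdist_cantor_le.
apply/nbhs_ballP; exists (2 ^- n) => /=; first by rewrite invr_gt0 exprn_gt0.
move=> y; rewrite ballEmdist/= => xy; apply: xA.
by apply: agree_mdist_cantor; exact: ltW.
Qed.

(** The identity from the product topology, compact by Tychonoff, is continuous: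
    finitely many digits determine a point up to any given distance. *)
Lemma cantor_compact : compact [set: cantor].
Proof.
have -> : [set: cantor] = (id : cantor_space -> cantor) @` [set: cantor_space].
  by apply/seteqP; split=> // x _; exists x.
apply: continuous_compact; last exact: cantor_space_compact.
apply: continuous_subspaceT => x A /nbhs_cantorP[n xA].
have : nbhs x [set y : cantor_space | forall i : 'I_n, y i = x i].
  apply: (@filter_forall _ _
    (fun (i : 'I_n) (y : cantor_space) => y i = x i) (nbhs x)) => i.
  apply: (@proj_continuous nat (fun=> bool) i x [set x i]).
  by apply: open_nbhs_nbhs; split => //; exact: discrete_open.
by apply: filterS => y yx; apply: xA => i ni; rewrite (yx (Ordinal ni)).
Qed.

Lemma continuous_cantor {Y : metricType R} (f : cantor -> Y) :
  (forall n x y, agree n x y -> mdist (f x) (f y) <= 2 ^- n) -> continuous f.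
Proof.
move=> fL x A /nbhs_ballP[e /= e0 eA]; apply/nbhs_cantorP.
have [n ne] := small_exp2 e0; exists n => y xy; apply: eA.
by rewrite ballEmdist/=; apply: le_lt_trans ne; exact: fL.
Qed.

(** Nested cylinders: [st j] is a point and a length, the cylinder they
    determine lies in U i for all i < j, and the lengths increase strictly, so
    that digit i of the limit point can be read off from [st i.+1]. *)
Lemma cantor_baire (U : nat -> set cantor) :
  (forall j, open (U j)) -> (forall j, dense (U j)) ->
  exists x, forall j, U j x.
Proof.
move=> oU dU.
have stepP (j : nat) (s : cantor * nat) : exists s' : cantor * nat,
    [/\ (s.2 < s'.2)%N, agree s.2 s.1 s'.1 &
        forall y, agree s'.2 s'.1 y -> U j y].
  case: s => x n /=; pose O := [set y : cantor | agree n x y].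
  have oO : open O.
    rewrite openE => y xy; apply/nbhs_cantorP; exists n => z;
      exact: agree_trans.
  have [|y [xy Uy]] := dU j O _ oO; first by exists x.
  have /nbhs_cantorP[m mU] : nbhs y (U j) by exact: open_nbhs_nbhs.
  exists (y, maxn n.+1 m); split=> //=; first by rewrite leq_max leqnn.
  by move=> z yz; apply: mU; apply: agree_le yz; rewrite leq_max leqnn orbT.
have /choice[step step_spec] : forall js : nat * (cantor * nat), exists s',
    [/\ (js.2.2 < s'.2)%N, agree js.2.2 js.2.1 s'.1 &
        forall y, agree s'.2 s'.1 y -> U js.1 y].
  by move=> [j s]; exact: stepP.
pose st j := iteri j (fun i s => step (i, s)) ((fun=> false) : cantor, 0%N).
have st_spec j : [/\ ((st j).2 < (st j.+1).2)%N,
    agree (st j).2 (st j).1 (st j.+1).1 &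
    forall y, agree (st j.+1).2 (st j.+1).1 y -> U j y].
  exact: (step_spec (j, st j)).
have st_le i j : (i <= j)%N -> ((st i).2 <= (st j).2)%N /\
    agree (st i).2 (st i).1 (st j).1.
  elim: j => [|j IH]; first by rewrite leqn0 => /eqP->.
  rewrite leq_eqVlt => /predU1P[->//|/IH[le ag]].
  have [lt ag' _] := st_spec j; split; first exact: leq_trans le (ltnW lt).
  by apply: agree_trans ag _; exact: agree_le ag'.
have st_ge j : (j <= (st j).2)%N.
  by elim: j => // j IH; have [lt _ _] := st_spec j; exact: leq_ltn_trans lt.
exists (fun i => (st i.+1).1 i) => j; have [_ _] := st_spec j; apply=> i ij.
have [le|/ltnW le] := leqP i.+1 j.+1.
  by have [_ ag] := st_le _ _ le; rewrite ag//; exact: st_ge.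
by have [_ ag] := st_le _ _ le; rewrite ag.
Qed.

End CantorMetric.

(** * The spectrum on the Cantor space *)

Section CantorSpectrum.
Context {R : realType}.
Local Notation cantor := (cantor R).
Implicit Types (x y b : cantor) (n m : nat).
Local Notation S := (compacts cantor * `]0%R : R, 1%R[%classic)%type.

(** The words of length m+1 give 2^(m+1) centres, where m is chosen with
    2^-(m+1) < r <= 2^-m. *)
Lemma covering_number_cantor_le (E : set cantor) (r : R) : 0 < r <= 1 ->
  (covering_number E r <= (2 * r^-1)%:E)%E.
Proof.
move=> r01; have /andP[r0 _] := r01; have [m /andP[mr rm]] := dyadic_scale r01.
pose word (w : m.+1.-tuple bool) : cantor := nth false w.
apply: (@le_trans _ _ (size [seq word w | w : m.+1.-tuple bool])%:R%:E).
  apply: covering_number_le_size => x _; pose w := [tuple x i | i < m.+1].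
  exists (word w) => /=; first by apply: map_f; rewrite mem_enum.
  rewrite ballEmdist/=; apply: le_lt_trans mr; apply: mdist_cantor_le => i im.
  by rewrite /word (nth_mktuple _ _ (Ordinal im)).
rewrite lee_fin size_map -cardE card_tuple card_bool natrX exprS ler_pM2l//.
by rewrite -[leLHS]invrK lef_pV2 ?posrE ?invr_gt0 ?exprn_gt0.
Qed.

(** Covering all of the space by at most 2 t^(-1/theta) balls of radius
    t^(1/theta) bounds the spectrum by (1/theta) / (1/theta - 1). *)
Lemma DeltaL_cantor_fin_num (p : S) : DeltaL cantor p \is a fin_num.
Proof.
rewrite ge0_fin_numE ?DeltaL_ge0//.
apply: (@le_lt_trans _ _ ((set_val p.2)^-1 / ((set_val p.2)^-1 - 1))%:E);
  last exact: ltry.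
apply: (@DeltaL_le _ _ p 2); near=> t.
have t0 : 0 < t by near: t; exact: nbhs_right_gt.
have t1 : t <= 1 by near: t; exact: nbhs_right_le.
have [x px] := compacts_neq0 p.1; exists x => //.
rewrite powRN; apply: covering_number_cantor_le.
rewrite powR_gt0//= powR_le1// ?t0//.
by rewrite invr_ge0 ltW// exponent_gt0.
Unshelve. all: by end_near. Qed.

(** The nonexpansive retraction of the space onto the subcube of b. *)
Definition mask b x : cantor := fun i => x i && b i.

Lemma agree_maskl n b x y : agree n x y -> agree n (mask b x) (mask b y).
Proof. by move=> xy i ni; rewrite /mask xy. Qed.

Lemma compact_range_mask b : compact (range (mask b)).
Proof.
apply: continuous_compact; last exact: cantor_compact.
apply/continuous_subspaceT/continuous_cantor => n x y xy.
by apply/mdist_cantor_le/agree_maskl.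
Qed.

Lemma range_mask_neq0 b : range (mask b) !=set0.
Proof. by exists (mask b (fun=> false)), (fun=> false). Qed.

Definition subcube b : compacts cantor :=
  Compacts (@compact_range_mask b) (range_mask_neq0 b).

Lemma subcubeP b x : compacts_set (subcube b) x <-> (forall i, x i -> b i).
Proof.
split=> [[y _ <-] i /andP[]//|xb]; exists x => //.
by apply/funext => i; rewrite /mask; case: (boolP (x i)) => // /xb ->.
Qed.

Lemma subcube_nbhd n b b' (e : R) : 2 ^- n < e -> agree n b b' ->
  compacts_set (subcube b) `<=` nbhd (compacts_set (subcube b')) e.
Proof.
move=> ne bb' x /subcubeP xb; exists (mask b' x); first by exists x.
apply: le_lt_trans ne; apply: mdist_cantor_le => i ni; rewrite /mask -bb'//.
by case: (boolP (x i)) => // /xb ->.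
Qed.

Lemma continuous_subcube : continuous subcube.
Proof.
apply: continuous_cantor => n b b' bb'; apply/ler_addgt0Pl => e e0.
have ne : 2 ^- n < e + 2 ^- n by rewrite ltrDr.
apply: hausdorff_dist_le; split.
- by apply: lt_trans ne; rewrite invr_gt0 exprn_gt0.
- exact: subcube_nbhd ne bb'.
- by apply: subcube_nbhd ne _; exact: agree_sym.
Qed.

(** A closed ball of radius at most 2^-n meets the subcube in its centre only. *)
Lemma DeltaL_subcube_finite n b th : (forall i, (n <= i)%N -> b i = false) ->
  (DeltaL cantor (subcube b, th) <= 0)%E.
Proof.
move=> b0; rewrite (_ : 0%E = (0 / ((set_val th)^-1 - 1))%:E);
  last by rewrite mul0r.
apply: (@DeltaL_le _ _ (subcube b, th) 1); near=> t.
have t0 : 0 < t by near: t; exact: nbhs_right_gt.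
have tn : t <= 2 ^- n.
  by near: t; apply: nbhs_right_le; rewrite invr_gt0 exprn_gt0.
have [x bx] := compacts_neq0 (subcube b); exists x => //.
rewrite oppr0 powRr0 mulr1; apply: (@covering_number_le_size _ _ _ _ [:: x]).
move=> y [/= xy yb]; exists x; rewrite /= ?inE//.
suff -> : x = y by apply: ballxx; exact: powR_gt0.
apply/funext => i; have [ni|ni] := ltnP i n.
  by apply: (@agree_mdist_cantor _ n) => //; exact: le_trans tn.
move/subcubeP: yb => /(_ i); move/subcubeP: bx => /(_ i); rewrite b0//.
by case: (x i) => [/(_ isT)//|_]; case: (y i) => [/(_ isT)|].
Unshelve. all: by end_near. Qed.

(** Let 2^-(k+1) < t <= 2^-k and 2^-(m+1) < r <= 2^-m. For k + 1 >= n, the ball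
    of radius t about x contains all points agreeing with x on k + 1 digits,
    and all of them lie in the subcube. A ball of radius r fixes the first m
    digits, so at least 2^(m - k - 1) >= (t / r) / 4 such balls are needed. *)
Lemma DeltaL_subcube_cofinite n b th : (forall i, (n <= i)%N -> b i = true) ->
  (1 <= DeltaL cantor (subcube b, th))%E.
Proof.
move=> b1.
apply: (@level_le_DeltaL _ _ (subcube b, th) 1 4^-1 (2 ^- n)).
- by rewrite invr_gt0.
- by rewrite invr_gt0 exprn_gt0.
move=> t /andP[t0 tn] x /subcubeP xb /=.
have t1 : t <= 1.
  by rewrite (le_trans tn)// invf_le1 ?exprn_gt0// exprn_ege1// ler1n.
set r := t `^ _.
have r0 : 0 < r by exact: powR_gt0.
have r1 : r <= 1.
  rewrite powR_le1// ?t0//.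
  by rewrite invr_ge0 ltW// (exponent_gt0 (subcube b, th)).
rewrite powRr1 ?divr_ge0 ?(ltW t0) ?(ltW r0)//.
have [k /andP[kt tk]] : exists k, 2 ^- k.+1 < t <= 2 ^- k.
  by apply: dyadic_scale; rewrite t0.
have [m /andP[mr rm]] : exists m, 2 ^- m.+1 < r <= 2 ^- m.
  by apply: dyadic_scale; rewrite r0.
have nk : (n <= k.+1)%N.
  rewrite leqNgt; apply/negP => kn; move: (lt_le_trans kt tn); apply/negP.
  by rewrite -leNgt lef_pV2 ?posrE ?exprn_gt0// ler_weXn2l ?ler1n// ltnW.
(* Truncated subtraction: for m <= k there is a single word, and the count 1 is
   still at least (t / r) / 4. *)
pose W : finType := (m - k.+1).-tuple bool.
pose e (w : W) : cantor :=
  fun i => if (i < k.+1)%N then x i else nth false w (i - k.+1).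
apply: (@le_trans _ _ (#|W|%:R)%:E).
  rewrite lee_fin card_tuple card_bool natrX.
  have h : t / r <= 2 ^- k * 2 ^+ m.+1.
    apply: ler_pM => //; [exact: ltW|by rewrite invr_ge0 ltW|].
    by rewrite -[leRHS]invrK lef_pV2 ?posrE ?invr_gt0 ?exprn_gt0// ltW.
  rewrite ler_pdivrMl//; apply: le_trans h _.
  rewrite mulrC ler_pdivrMr ?exprn_gt0//.
  rewrite (_ : 4 = 2 ^+ 2 :> R); last by rewrite expr2 -natrM.
  rewrite -!exprD ler_weXn2l ?ler1n//; lia.
apply: (card_le_covering_number (e := e)) => [w|c w w'].
  split.
    apply: (le_trans _ (ltW kt)); apply: mdist_cantor_le => i ik.
    by rewrite /e ik.
  apply/(subcubeP b) => i; rewrite /e; case: ltnP => [_ /xb//|ki _].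
  by rewrite b1// (leq_trans nk).
rewrite !ballEmdist/= => cw cw'.
have ww' : agree m (e w) (e w').
  apply: (agree_trans (y := c)).
    by apply/agree_sym/agree_mdist_cantor; rewrite (le_trans (ltW cw)).
  by apply/agree_mdist_cantor; rewrite (le_trans (ltW cw')).
apply: eq_from_tnth => j; rewrite !(tnth_nth false).
have := ww' (k.+1 + j)%N.
rewrite /e [(_ < k.+1)%N]ltnNge leq_addr [negb _]/= addKn; apply.
by have := ltn_ord j; lia.
Qed.

(** The oscillation already occurs along b |-> F_b at the exponent 1/2.
    Category yields a b at which the approximants are below 1/3 infinitely
    often and above 2/3 infinitely often, so their limit can be neither above
    nor at most 1/2. *)
Lemma not_baire1_DeltaL_cantor : ~ baire_class 1 (DeltaL cantor).
Proof.
have half01 : 2^-1 \in (`]0%R : R, 1%R[%classic).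
  by rewrite inE/= in_itv/= invr_gt0 ltr0n/= invf_lt1// ltr1n.
pose th : `]0%R : R, 1%R[%classic := SigSub half01.
pose phi b : S := (subcube b, th).
have cphi : continuous phi.
  move=> b; apply: (@cvg_pair _ _ _ (nbhs b) (nbhs (subcube b)) (nbhs th)).
    exact: continuous_subcube.
  exact: cvg_cst.
move=> /(baire_class_precomp cphi)[g [cg gD]].
pose low k := [set b | (g k b < (1/3)%:E)%E].
pose high k := [set b | ((2/3)%:E < g k b)%E].
have o_low k : open (low k).
  apply: (@open_comp _ _ (g k) [set y | (y < (1/3)%:E)%E]);
    last exact: open_ereal_lt_ereal.
  by move=> b _; exact: cg.
have o_high k : open (high k).
  apply: (@open_comp _ _ (g k) [set y | ((2/3)%:E < y)%E]);
    last exact: open_ereal_gt_ereal.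
  by move=> b _; exact: cg.
have dense_tail (v : bool) (P : nat -> set cantor) j :
    (forall n b, (forall i, (n <= i)%N -> b i = v) ->
      \forall k \near \oo, P k b) ->
    dense (\bigcup_(k in [set k | (j <= k)%N]) P k).
  move=> Pv O [b Ob] oO.
  have /nbhs_cantorP[n nO] : nbhs b O by exact: open_nbhs_nbhs.
  pose b' : cantor := fun i => if (i < n)%N then b i else v.
  have [|k0 _ kP] := Pv n b'; first by move=> i ni; rewrite /b' ltnNge ni.
  exists b'; split; first by apply: nO => i ni; rewrite /b' ni.
  exists (maxn j k0); rewrite /= ?leq_maxl//; apply: kP => /=; exact: leq_maxr.
have Dlow n b : (forall i, (n <= i)%N -> b i = false) ->
  \forall k \near \oo, low k b.
  move=> b0; apply: (gD b [set y | (y < (1/3)%:E)%E]); apply: open_nbhs_nbhs;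
    split; first exact: open_ereal_lt_ereal.
  by apply: le_lt_trans (DeltaL_subcube_finite th b0) _; rewrite lte_fin; lra.
have Dhigh n b : (forall i, (n <= i)%N -> b i = true) ->
  \forall k \near \oo, high k b.
  move=> b0; apply: (gD b [set y | ((2/3)%:E < y)%E]); apply: open_nbhs_nbhs;
    split; first exact: open_ereal_gt_ereal.
  by apply: lt_le_trans (DeltaL_subcube_cofinite th b0); rewrite lte_fin; lra.
pose U j := (\bigcup_(k in [set k | (j <= k)%N]) low k) `&`
            (\bigcup_(k in [set k | (j <= k)%N]) high k).
have oL j : open (\bigcup_(k in [set k | (j <= k)%N]) low k).
  exact: bigcup_open.
have oH j : open (\bigcup_(k in [set k | (j <= k)%N]) high k).
  exact: bigcup_open.
have [||b bU] := @cantor_baire _ U.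
- by move=> j; apply: openI.
- move=> j O O0 oO; rewrite /U setIA; apply: (dense_tail true) => //;
    last exact: openI.
  exact: (dense_tail false).
have [l|l] := leP (DeltaL cantor (phi b)) (1/2)%:E.
  have [N _ NP] : \forall k \near \oo, (g k b < (2/3)%:E)%E.
    apply: (gD b [set y | (y < (2/3)%:E)%E]); apply: open_nbhs_nbhs; split;
      first exact: open_ereal_lt_ereal.
    by apply: le_lt_trans l _; rewrite lte_fin; lra.
  have [_ [k /= Nk]] := bU N; rewrite /high/= => /(lt_trans (NP k Nk)).
  by rewrite ltxx.
have [N _ NP] : \forall k \near \oo, ((1/3)%:E < g k b)%E.
  apply: (gD b [set y | ((1/3)%:E < y)%E]); apply: open_nbhs_nbhs; split;
    first exact: open_ereal_gt_ereal.
  by apply: lt_trans l; rewrite lte_fin; lra.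
have [[k /= Nk] kl _] := bU N; move: (lt_trans kl (NP k Nk)).
by rewrite ltxx.
Qed.

End CantorSpectrum.

Theorem theorem5p2 (R : realType) :
  (forall X : metricType R, compact [set: X] -> [set: X] !=set0 ->
     [/\ baire_class 2 (DeltaL X), borel_measurable (DeltaL X) &
       (forall p, DeltaL X p \is a fin_num) ->
         baire_class 2 (fine \o DeltaL X) /\
         borel_measurable (fine \o DeltaL X)]) /\
  (exists X : metricType R,
     [/\ compact [set: X], [set: X] !=set0,
         forall p, DeltaL X p \is a fin_num,
         ~ baire_class 1 (DeltaL X) &
         ~ baire_class 1 (fine \o DeltaL X)]).
Proof.
split=> [X _ _|].
  split; [exact: DeltaL_baire2|exact: baire_class_borel (@DeltaL_baire2 _ X)|].
  move=> Dfin; split; first exact: fine_DeltaL_baire2.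
  exact: baire_class_borel (fine_DeltaL_baire2 Dfin).
have Dfin := @DeltaL_cantor_fin_num R.
exists (cantor R); split => //;
  [exact: cantor_compact|by exists (fun=> false)| |].
  exact: not_baire1_DeltaL_cantor.
move=> /(baire_class_comp (@continuous_EFin R)).
have -> : EFin \o (fine \o DeltaL (cantor R)) = DeltaL (cantor R).
  by apply/funext => p /=; rewrite fineK.
exact: not_baire1_DeltaL_cantor.
Qed.
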